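(* Let $\mathcal F=(\square;f_1,f_2,f_3,f_4)$ and $\mathcal G=(\square;g_1,g_2,g_3,g_4)$ be two contractive four-map bi-affine iterated function systems on the unit square $\square$ of the type described in the context, built from points $O,Q,R,S,T$ and $O',Q',R',S',T'$ respectively. Let $\pi_G$ be the coding map of $\mathcal G$ and let $\tau_F=\tau_{M_F}$ be the section of the coding map of $\mathcal F$ given by the mask $M_F$. Then the map $h=\pi_G\circ\tau_F:\square\to\square$ is a homeomorphism.
   Context: $\square=[0,1]^2$ is the unit square with vertices $A,B,C,D$ in cyclic order. A map is bi-affine if it has the form $(x,y)\mapsto \mathbf a+\mathbf b x+\mathbf c y+\mathbf d xy$ with $\mathbf a,\mathbf b,\mathbf c,\mathbf d\in\mathbb{R}^2$; it is uniquely determined by the images of the four vertices of $\square$. The IFS $\mathcal F$: choose a point $O$ in the interior of $\square$ and points $Q,R,S,T$ in the relative interiors of the sides $AB,BC,CD,DA$ respectively, such that the quadrilaterals $AQOT$, $BQOR$, $CSOR$, $DSOT$ are convex. Fix a labelling $v_1,v_2,v_3,v_4$ of the vertices of $\square$ in cyclic order (in one of the two orientations). The $f_i$ are the bi-affine maps taking $(v_1,v_2,v_3,v_4)$ respectively to $f_1:(A,Q,O,T)$, $f_2:(B,Q,O,R)$, $f_3:(C,S,O,R)$, $f_4:(D,S,O,T)$. Thus each $f_i$ maps $\square$ onto a quadrilateral containing exactly one vertex of $\square$, and maps whose images share a side agree on its preimage. The IFS $\mathcal G$ is defined in the same way, with the same labelling $v_1,\dots,v_4$ and with points $O',Q',R',S',T'$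 (satisfying the same conditions) replacing $O,Q,R,S,T$. Both IFSs are assumed contractive, i.e. each map is a contraction of $\square$ with respect to the Euclidean metric. The attractor of each is $\square$ (the attractor of a contractive IFS is the unique nonempty compact set equal to the union of its images under the maps). Coding map: let $\Omega=\{1,2,3,4\}^\infty$; for $\sigma=i_0i_1i_2\cdots\in\Omega$, $\pi_G(\sigma)=\lim_{k\to\infty}g_{i_0}\circ g_{i_1}\circ\cdots\circ g_{i_k}(x)$, which exists and is independent of $x\in\square$; similarly $\pi_F$. Mask and section: $M_F=\{M_1,M_2,M_3,M_4\}$ is the partition of $\square$ given by $M_i=f_i(\square)\setminus\bigcup_{j=1}^{i-1}f_j(\square)$, $i=1,2,3,4$. Define $T_F:\square\to\square$ by $T_F(x)=f_i^{-1}(x)$ for $x\in M_i$ (inverse of $f_i$ on $\square$). Then $\tau_F(x)=\tau_{M_F}(x)=i_0i_1i_2\cdots\in\Omega$, where $i_k$ is the unique index with $T_F^k(x)\in M_{i_k}$; it satisfies $\pi_F\circ\tau_F=\mathrm{id}_\square$. *)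

(* Defs.v *)
From HB Require Import structures.
From mathcomp Require Export all_boot all_order all_algebra.
From mathcomp Require Export all_classical all_reals all_analysis.
Set Implicit Arguments.
Unset Strict Implicit.
Unset Printing Implicit Defensive.
Import Order.TTheory GRing.Theory Num.Theory.
Import numFieldNormedType.Exports.
Local Open Scope classical_set_scope.
Local Open Scope ring_scope.

Section Plane.
Variable K : realType.
Implicit Types p q x y : K * K.

Definition square : set (K * K) := `[0, 1] `*` `[0, 1].

Definition corners : seq (K * K) := [:: (0, 0); (1, 0); (1, 1); (0, 1)].

(* All eight labellings of the corners in cyclic order: any first corner,
   either orientation. *)
Definition cyclic_labelling (s : seq (K * K)) : Prop :=
  exists k : nat, s = rot k corners \/ s = rot k (rev corners).

Definition open_segment p q : set (K * K) :=
  [set (1 - t) *: p + t *: q | t in `]0, 1[].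

(* The library's norm on [K * K] is the max norm. *)
Definition edist x y : K :=
  Num.sqrt ((x.1 - y.1) ^+ 2 + (x.2 - y.2) ^+ 2).

Definition orient p q x : K :=
  (q.1 - p.1) * (x.2 - p.2) - (q.2 - p.2) * (x.1 - p.1).

(* The closed polygon with vertex list [s] lies on one side of the line through
   each of its edges.  Inequalities are not strict, so an interior angle of 180
   degrees is allowed. *)
Definition convex_polygon (s : seq (K * K)) : bool :=
  all (fun e => all (fun x => 0 <= orient e.1 e.2 x) s
             || all (fun x => orient e.1 e.2 x <= 0) s)
      (zip s (rot 1 s)).

Definition biaffine (f : K * K -> K * K) : Prop :=
  exists a b c d : K * K, forall z,
    f z = a + z.1 *: b + z.2 *: c + (z.1 * z.2) *: d.

Definition contractive_on (D : set (K * K)) (f : K * K -> K * K) : Prop :=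
  exists2 c : K, c < 1 &
    forall x y, D x -> D y -> edist (f x) (f y) <= c * edist x y.

End Plane.

Arguments square {K}.
Arguments corners {K}.

Definition homeomorphism (X Y : topologicalType) (D : set X) (E : set Y)
    (h : X -> Y) : Prop :=
  exists k : Y -> X,
    [/\ set_fun D E h, set_fun E D k,
        {in D, cancel h k}, {in E, cancel k h} &
        {within D, continuous h} /\ {within E, continuous k}].

Section IFS.
Variable K : realType.

Definition cells (A B C D O Q R S T : K * K) : seq (seq (K * K)) :=
  [:: [:: A; Q; O; T]; [:: B; Q; O; R]; [:: C; S; O; R]; [:: D; S; O; T]].

Definition admissible (A B C D O Q R S T : K * K) : Prop :=
  [/\ square° O,
      [/\ open_segment A B Q, open_segment B C R,
          open_segment C D S & open_segment D A T] &
      all (@convex_polygon K) (cells A B C D O Q R S T)].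

(* Maps and symbols are indexed by 0, 1, 2, 3 rather than 1, 2, 3, 4.  Each
   [f i] is the bi-affine formula on the whole plane; only its restriction to
   the square matters. *)
Definition biaffine_ifs (A B C D : K * K) (v : seq (K * K))
    (O Q R S T : K * K) (f : 'I_4 -> K * K -> K * K) : Prop :=
  [/\ admissible A B C D O Q R S T,
      forall i, biaffine (f i) &
      forall i, [seq f i x | x <- v] = nth [::] (cells A B C D O Q R S T) i].

Definition contractive_ifs (f : 'I_4 -> K * K -> K * K) : Prop :=
  forall i, contractive_on square (f i).

Definition word := nat -> 'I_4.

(* [foldr f x (mkseq s k.+1)] is f_(s 0) (f_(s 1) (... (f_(s k) x))).  The limit
   is taken directly as the chosen common limit over all base points x, since
   [lim] is not available on [K * K], which has no [pnbhsType] instance. *)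
Definition coding_map (f : 'I_4 -> K * K -> K * K) (s : word) : K * K :=
  get [set p : K * K | forall x, square x ->
    foldr f x (mkseq s k.+1) @[k --> \oo] --> p].

Definition mask (f : 'I_4 -> K * K -> K * K) (i : 'I_4) : set (K * K) :=
  f i @` square `\` \bigcup_(j in [set j : 'I_4 | (j < i)%N]) (f j @` square).

Definition mask_index (f : 'I_4 -> K * K -> K * K) (x : K * K) : 'I_4 :=
  xget ord0 [set i | mask f i x].

Definition mask_map (f : 'I_4 -> K * K -> K * K) (x : K * K) : K * K :=
  'pinv_(fun=> 0) square (f (mask_index f x)) x.

Definition mask_section (f : 'I_4 -> K * K -> K * K) (x : K * K) : word :=
  fun k => mask_index f (iter k (mask_map f) x).

End IFS.

(* Main.v *)
Require Import Defs.
From mathcomp Require Import all_boot all_order all_algebra ring lra.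
From mathcomp Require Import all_classical all_reals all_analysis.
Set Implicit Arguments.
Unset Strict Implicit.
Unset Printing Implicit Defensive.
Import numFieldNormedType.Exports.
Import Order.TTheory GRing.Theory Num.Theory.

(** Write [square] as the union of the four cells [f i @` square], and likewise
    for [g].  The map [h = coding_map g \o mask_section f] should satisfy
    [h \o f i = g i \o h].  This is a functional equation which can be solved
    by iteration: starting from the identity, replace [phi] by the map that on
    the cell [f i @` square] equals [g i \o phi \o (f i)^-1].  The iterate of
    rank [n] is [conj_iter f g n]; by the contraction property these iterates
    converge uniformly to [h] (lemma [conj_iter_approx]).

    The point of the proof is that each iterate is well defined and continuous
    although [mask_map] jumps across the boundaries of the cells.  Two different
    cells of [f] meet in the image of one side, or of one corner, of the square,
    and the two maps agree on this side or corner; so do the corresponding maps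
    of [g].  Hence the gluing works as soon as [phi] sends every side of the square
    into itself, and this property is inherited by the next iterate.  It is
    expressed by the relation [face x y]: the smallest closed face of the square
    that contains [x] also contains [y].  What is needed of the pair [(f, g)]
    is then the predicate [face_compatible], and [conj_iter_spec] is the
    induction.  Continuity passes to the uniform limit [h], and so does the
    equation [h \o f i = g i \o h].  Exchanging [f] and [g] gives [h'] with
    [h' \o g i = f i \o h']; then [h' \o h] commutes with every [f i], and the
    only such self-map of the square is the identity ([commuting_id]).  Hence
    [h'] is the inverse of [h].

    It remains to check the geometric hypotheses.  A labelling of the corners
    is a symmetry of the square, so up to a symmetry before and one after it,
    and up to the mirror images that exchange the four cells, every [f i] is
    the standard map [quad a b c d], which takes the corners to [(0, 0)],
    [(a, 0)], [(c, d)], [(0, b)].  Convexity of the cell becomes the inequality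
    [a * b <= c * b + d * a], which says that the Jacobian at [(1, 1)] is not
    negative.  It yields
    - injectivity ([quad_inj]): the difference of two values of a bi-affine map
      is the differential at the midpoint applied to the difference of the
      arguments, and this differential is invertible off the corner [(1, 1)];
    - the overlaps ([cell_overlap]): the two cells to the left and the two to
      the right of the hub are separated by the broken line joining the
      division points of the lower and upper side through the hub.
    That the cells cover the square ([cell_cover]) follows from the
    intermediate value theorem, applied to the broken lines that sweep a lower
    and an upper strip. *)

Local Open Scope classical_set_scope.
Local Open Scope ring_scope.

(** * Conjugating two systems of maps of the square *)

Section Conjugacy.
Variable K : realType.
Implicit Types (x y z p : K * K) (s : word).

Lemma squareE x : square x <-> 0 <= x.1 <= 1 /\ 0 <= x.2 <= 1.
Proof. by rewrite /square/=; split=> -[]; rewrite !in_itv. Qed.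

(** The smallest closed face of the square (corner, side or the whole square)
    that contains [x] also contains [y]. *)
Definition face x y : Prop :=
  [/\ square y, x.1 = 0 -> y.1 = 0, x.1 = 1 -> y.1 = 1,
      x.2 = 0 -> y.2 = 0 & x.2 = 1 -> y.2 = 1].

Lemma face_refl x : square x -> face x x. Proof. by []. Qed.

Lemma face_square x y : face x y -> square y. Proof. by case. Qed.

Lemma compact_square : compact (@square K).
Proof. by apply: compact_setX; exact: segment_compact. Qed.

Lemma closed_square : closed (@square K).
Proof. exact: compact_closed (@norm_hausdorff _ _) compact_square. Qed.

Definition small_after (f : 'I_4 -> K * K -> K * K) N (e : K) : Prop :=
  forall (w : seq 'I_4) x y, (N <= size w)%N -> square x -> square y ->
    `|foldr f x w - foldr f y w| <= e.

Definition shrinking (f : 'I_4 -> K * K -> K * K) : Prop :=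
  forall e, 0 < e -> exists N, small_after f N e.

Definition self_covering (f : 'I_4 -> K * K -> K * K) : Prop :=
  [/\ forall i x, square x -> square (f i x),
      forall x, square x -> exists i, (f i @` square) x,
      forall i, continuous (f i) & shrinking f].

(** The first clause with [i = j] is the injectivity of [f i].  For [i != j] it
    says that a common point of two cells of [f] has one preimage under both
    maps, and that [g i] and [g j] agree on the face of this preimage.  The
    second clause says that whenever a face of a cell of [f] lies in a face of
    the square, the same holds for the corresponding faces of [g]. *)
Definition face_compatible (f g : 'I_4 -> K * K -> K * K) : Prop :=
  (forall i j y z, square y -> square z -> f i y = f j z ->
     y = z /\ forall y', face y y' -> g i y' = g j y') /\
  (forall i y y', square y -> face y y' -> face (f i y) (g i y')).

Lemma foldr_square (f : 'I_4 -> K * K -> K * K) w x :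
  (forall i y, square y -> square (f i y)) -> square x -> square (foldr f x w).
Proof. by move=> fS; elim: w => //= i w IH /IH/fS. Qed.

Lemma mask_mapP f x : self_covering f -> square x ->
  square (mask_map f x) /\ f (mask_index f x) (mask_map f x) = x.
Proof.
move=> [_ cov _ _] /cov[i0 fi0].
have [|j jx minj] := @arg_minnP _ i0 (fun i => `[< (f i @` square) x >]) val.
  exact/asboolP.
have : exists i : 'I_4, Defs.mask f i x.
  exists j; split; first exact/asboolP.
  by move=> [k /= kj kx]; have := minj k (asboolT kx); rewrite leqNgt kj.
move=> /(xgetPex ord0)[]; rewrite -/(mask_index f x) => hx _.
rewrite /mask_map; split; last by apply: pinvK; exact: mem_set.
by apply: (@surjpinv_image_sub _ _ (fun=> 0) _
  (f (mask_index f x) @` square) (f (mask_index f x))).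
Qed.

Lemma mkseq_mask_section f n x : mkseq (mask_section f x) n.+1 =
  mask_index f x :: mkseq (mask_section f (mask_map f x)) n.
Proof.
rewrite /mkseq /= (iotaDl 1 0) -map_comp; congr cons; apply: eq_map => k /=.
by rewrite /mask_section /= -iterSr.
Qed.

(** Defined by recursion on the first symbol of the address, so that each step
    applies the gluing operator to the preceding iterate; [conj_iterE] unfolds
    it along the whole address. *)
Fixpoint conj_iter (f g : 'I_4 -> K * K -> K * K) n x : K * K :=
  if n is m.+1 then g (mask_index f x) (conj_iter f g m (mask_map f x)) else x.

Lemma conj_iterE f g n x :
  conj_iter f g n x =
  foldr g (iter n (mask_map f) x) (mkseq (mask_section f x) n).
Proof.
by elim: n x => [|n IH] x //; rewrite mkseq_mask_section iterSr /= IH.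
Qed.

Lemma mask_section_foldr f n x : self_covering f -> square x ->
  square (iter n (mask_map f) x) /\
  foldr f (iter n (mask_map f) x) (mkseq (mask_section f x) n) = x.
Proof.
move=> tf; elim: n x => [|n IH] x // xS.
have [TS fT] := mask_mapP tf xS; have [TnS fTn] := IH _ TS.
by rewrite mkseq_mask_section iterSr /= fTn.
Qed.

(** Compactness gives a cluster point of one orbit along the address [s].  It is
    within [e] of every tail, because the tails lie in nested sets of small
    diameter, so the orbits of all base points converge to it. *)
Lemma coding_mapP g s : self_covering g ->
  square (coding_map g s) /\ forall e N, small_after g N e ->
    forall n x, (N <= n)%N -> square x ->
    `|coding_map g s - foldr g x (mkseq s n)| <= e.
Proof.
move=> [gS _ _ gshr]; have S0 : square (0 : K * K).
  by apply/squareE; rewrite /= lexx ler01.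
have aS n : square (foldr g 0 (mkseq s n)) by exact: foldr_square.
have [|p [pS clp]] := compact_square (F := foldr g 0 (mkseq s n) @[n --> \oo]).
  by exists 0%N => // n _; exact: aS.
have hp e N : small_after g N e -> forall n x, (N <= n)%N -> square x ->
    `|p - foldr g x (mkseq s n)| <= e.
  move=> hN n x Nn xS; set b := foldr g x (mkseq s n).
  suff : closed_ball_ Num.norm b e p by rewrite /closed_ball_/= distrC.
  apply: closed_closed_ball_ => B Bp; apply: clp Bp.
  exists n => // m /= nm; rewrite /closed_ball_/=.
  have -> : mkseq s m = mkseq s n ++ drop n (mkseq s m).
    rewrite -{1}[mkseq s m](cat_take_drop n) -map_take take_iota.
    by rewrite (minn_idPl nm).
  rewrite foldr_cat; apply: hN => //; first by rewrite size_mkseq.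
  exact: foldr_square.
suff -> : coding_map g s = p by [].
have pcvg x : square x -> foldr g x (mkseq s k.+1) @[k --> \oo] --> p.
  move=> xS; apply/cvgrPdist_le => e /gshr[N /hp hN].
  exists N => // n Nn; apply: (hN n.+1 x) => //; exact: leqW Nn.
have /(_ _ pS) getcvg := @getPex _ [set q : K * K | forall x, square x ->
  foldr g x (mkseq s k.+1) @[k --> \oo] --> q] (ex_intro _ p pcvg).
exact: (cvg_unique (@norm_hausdorff _ _) getcvg (pcvg _ pS)).
Qed.

Lemma square_coding_map g s : self_covering g -> square (coding_map g s).
Proof. by move=> /(coding_mapP s)[]. Qed.

Section Pair.
Variables f g : 'I_4 -> K * K -> K * K.
Hypotheses (tf : self_covering f) (tg : self_covering g) (fg : face_compatible f g).
Let h x := coding_map g (mask_section f x).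

(** The two halves feed each other: since the iterate of rank [n] maps every
    point into its own face, the value of the next one at [f i y] does not
    depend on the cell chosen by the mask; this in turn makes the next one
    respect faces. *)
Lemma conj_iter_spec n :
  (forall x, square x -> face x (conj_iter f g n x)) /\
  (forall i y, square y ->
     conj_iter f g n.+1 (f i y) = g i (conj_iter f g n y)).
Proof.
have [fS _ _ _] := tf; have [glue side] := fg.
have step m : (forall x, square x -> face x (conj_iter f g m x)) ->
    forall i y, square y ->
      conj_iter f g m.+1 (f i y) = g i (conj_iter f g m y).
  move=> IH i y yS /=; have [TS fT] := mask_mapP tf (fS i y yS).
  have [<- gg] := glue _ _ _ _ yS TS (esym fT).
  by rewrite -gg //; apply: IH.
elim: n => [|n [IHface IHstep]].
  by split; [exact: face_refl|exact: (step 0%N (@face_refl))].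
have IHface' x : square x -> face x (conj_iter f g n.+1 x).
  move=> xS; have [TS fT] := mask_mapP tf xS.
  by rewrite -{1}fT /=; apply: side => //; exact: IHface.
by split=> //; exact: step.
Qed.

(** The preimage of [C] under the next iterate is a finite union of compact sets,
    the images by [f i] of the preimages of [g i @^-1` C]. *)
Lemma conj_iter_closed n (C : set (K * K)) : closed C ->
  closed (square `&` conj_iter f g n @^-1` C).
Proof.
have [_ _ fC _] := tf; have [_ _ gC _] := tg; have [fS _ _ _] := tf.
elim: n C => [|n IH] C clC; first exact: closedI closed_square clC.
have [_ step] := conj_iter_spec n.
have -> : square `&` conj_iter f g n.+1 @^-1` C =
    \bigcup_(i in [set: 'I_4])
      f i @` (square `&` conj_iter f g n @^-1` (g i @^-1` C)).
  apply/seteqP; split=> [x [xS xC]|x [i _ [y [yS yC] <-]]].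
    have [TS fT] := mask_mapP tf xS.
    by exists (mask_index f x) => //; exists (mask_map f x).
  by split; [exact: fS|rewrite /preimage/= -/(conj_iter f g n.+1 (f i y)) step].
apply: closed_bigcup => [|i _]; first exact: finite_finset.
apply: compact_closed; first exact: norm_hausdorff.
apply: continuous_compact; first exact: continuous_subspaceT.
apply: subclosed_compact compact_square _ => //.
by apply: IH; apply: preimage_closed => // ? _; exact: gC.
Qed.

Lemma conj_iter_continuous n : {within square, continuous (conj_iter f g n)}.
Proof.
apply/continuous_closedP => C clC; apply/closed_subspaceP.
exists (square `&` conj_iter f g n @^-1` C); first exact: conj_iter_closed.
by rewrite setIC setIA setIid setIC.
Qed.

Lemma conj_iter_approx e : 0 < e -> exists N, forall n x, (N <= n)%N ->
  square x -> `|h x - conj_iter f g n x| <= e.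
Proof.
have [_ _ _ gshr] := tg => /gshr[N hN]; exists N => n x Nn xS.
have [TnS _] := mask_section_foldr n tf xS; rewrite conj_iterE.
by have [_ /(_ e N hN) bound] := coding_mapP (mask_section f x) tg; exact: bound.
Qed.

Lemma conjugation_continuous : {within square, continuous h}.
Proof.
apply/subspace_continuousP => x xS; apply/cvgrPdist_le => e e0.
have e3 : 0 < e / 3 by lra.
have [N hN] := conj_iter_approx e3.
have /subspace_continuousP/(_ x xS)/cvgrPdist_le/(_ _ e3) near_x :=
  @conj_iter_continuous N.
set phi := conj_iter f g N in hN near_x.
near=> y.
have yS : square y by near: y; exact: withinT.
have : `|phi x - phi y| <= e / 3 by near: y; exact: near_x.
have := hN N _ (leqnn N) xS; have := hN N _ (leqnn N) yS; rewrite -/phi => hy hx.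
have -> : h x - h y = (h x - phi x) + (phi x - phi y) - (h y - phi y).
  by rewrite addrA subrK opprB addrA subrK.
have := ler_normB (h x - phi x + (phi x - phi y)) (h y - phi y).
have := ler_normD (h x - phi x) (phi x - phi y).
lra.
Unshelve. all: by end_near. Qed.

Lemma conj_iter_cvg x : square x -> conj_iter f g n x @[n --> \oo] --> h x.
Proof.
move=> xS; apply/cvgrPdist_le => e /conj_iter_approx[N hN].
by exists N => // n /= Nn; exact: hN.
Qed.

Lemma conjugationE i y : square y -> h (f i y) = g i (h y).
Proof.
move=> yS; have [fS _ _ _] := tf; have [_ _ gC _] := tg.
apply: (@cvg_unique _ (@norm_hausdorff _ _)
  (conj_iter f g n.+1 (f i y) @[n --> \oo])).
  apply: (@cvg_comp _ _ _ (addn 1) (conj_iter f g ^~ (f i y))).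
    exact: cvg_addnl.
  exact: conj_iter_cvg (fS i y yS).
have -> : (fun n => conj_iter f g n.+1 (f i y)) = g i \o (conj_iter f g ^~ y).
  by apply/funext => n; exact: (conj_iter_spec n).2.
exact: continuous_cvg (gC i _) (conj_iter_cvg yS).
Qed.

End Pair.

(** Both [x] and [k x] lie in the image of the square under every finite
    composition of the [f i] along the address of [x], and the diameters of
    these images tend to zero. *)
Lemma commuting_id f (k : K * K -> K * K) x : self_covering f ->
  (forall y, square y -> square (k y)) ->
  (forall i y, square y -> k (f i y) = f i (k y)) ->
  square x -> k x = x.
Proof.
move=> tf kS kf xS; have [fS _ _ fshr] := tf.
have kw w y : square y -> k (foldr f y w) = foldr f (k y) w.
  by move=> yS; elim: w => //= i w <-; apply: kf; exact: foldr_square.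
apply/eqP; rewrite -subr_eq0 -normr_le0; apply/ler_addgt0Pl => e e0; rewrite addr0.
have [n hn] := fshr e e0; have [TS fT] := mask_section_foldr n tf xS.
rewrite -{1}fT kw// -{3}fT; apply: hn => //; last exact: kS.
by rewrite size_mkseq.
Qed.

Theorem conjugation_homeomorphism f g :
  self_covering f -> self_covering g -> face_compatible f g -> face_compatible g f ->
  homeomorphism square square (fun x => coding_map g (mask_section f x)).
Proof.
have inv f' g' : self_covering f' -> self_covering g' ->
    face_compatible f' g' -> face_compatible g' f' ->
  {in square, cancel (fun x => coding_map g' (mask_section f' x))
                     (fun x => coding_map f' (mask_section g' x))}.
  move=> tf tg fg gf x /set_mem xS.
  apply: (@commuting_id f' (fun y => coding_map f'
    (mask_section g' (coding_map g' (mask_section f' y))))) => // *.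
    exact: square_coding_map.
  by rewrite conjugationE// conjugationE//; exact: square_coding_map.
move=> tf tg fg gf; exists (fun x => coding_map f (mask_section g x)); split.
- by move=> x _; exact: square_coding_map.
- by move=> x _; exact: square_coding_map.
- exact: inv.
- exact: inv.
- by split; exact: conjugation_continuous.
Qed.
End Conjugacy.

(** * Symmetries of the square *)

Section Geometry.
Variable K : realType.
Implicit Types (p q x y z : K * K) (a b c d s t u w : K).

Definition flip (e : bool) t := if e then 1 - t else t.

Definition mirror (ex ey : bool) p : K * K := (flip ex p.1, flip ey p.2).

(** The eight symmetries: [e.1.1] exchanges the coordinates, then [e.1.2] and
    [e.2] reflect the first and the second one. *)
Definition symm (e : bool * bool * bool) p : K * K :=
  mirror e.1.2 e.2 (if e.1.1 then (p.2, p.1) else p).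

Definition symmV (e : bool * bool * bool) :=
  if e.1.1 then (true, e.2, e.1.2) else e.

Lemma symmK e : cancel (symm e) (symm (symmV e)).
Proof.
by case: e => [[[] []] []] [x y]; rewrite /symm/mirror/=; congr pair; ring.
Qed.

Lemma symmVK e : cancel (symm (symmV e)) (symm e).
Proof.
by case: e => [[[] []] []] [x y]; rewrite /symm/mirror/=; congr pair; ring.
Qed.

Lemma face_mirror ex ey x y : face x y -> face (mirror ex ey x) (mirror ex ey y).
Proof.
case=> /squareE[sx sy] h1 h2 h3 h4; split=> /=; first by
 apply/squareE; case: ex ey => -[]; rewrite /mirror/flip/=; split; lra.
- by case: ex => /=; [move=> H; have/h2 : x.1 = 1 by lra| ]; lra.
- by case: ex => /=; [move=> H; have/h1 : x.1 = 0 by lra| ]; lra.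
- by case: ey => /=; [move=> H; have/h4 : x.2 = 1 by lra| ]; lra.
- by case: ey => /=; [move=> H; have/h3 : x.2 = 0 by lra| ]; lra.
Qed.

Lemma face_symm e x y : face x y -> face (symm e x) (symm e y).
Proof.
move=> H; apply: face_mirror; case: e.1.1 => //.
by case: H => /squareE[? ?] *; split=> //; apply/squareE.
Qed.

Lemma symm_square e x : square x -> square (symm e x).
Proof. by move=> /face_refl/(face_symm e)/face_square. Qed.

(** * The standard cell *)

(** The bi-affine map taking [(0, 0)], [(1, 0)], [(1, 1)], [(0, 1)] to [(0, 0)],
    [(a, 0)], [(c, d)], [(0, b)]. *)
Definition quad a b c d p : K * K :=
  (p.1 * ((1 - p.2) * a + p.2 * c), p.2 * ((1 - p.1) * b + p.1 * d)).

(** The last inequality says that [(c, d)] is not below the line through [(a, 0)]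
    and [(0, b)], which is the convexity of the cell. *)
Definition good_cell a b c d : Prop :=
  [/\ 0 < a < 1, 0 < b < 1, 0 < c < 1, 0 < d < 1 & a * b <= c * b + d * a].

Lemma convex_comb_itv s t u : 0 <= s <= 1 -> 0 < t < 1 -> 0 < u < 1 ->
  0 < (1 - s) * t + s * u < 1.
Proof.
move=> hs ht hu; have [s0|s0] : s = 0 \/ 0 < s.
    by case: (ltP 0 s); [right|left; lra].
  by rewrite s0; lra.
have : 0 < s * u /\ 0 < s * (1 - u) by split; apply: mulr_gt0; lra.
have : 0 <= (1 - s) * t /\ 0 <= (1 - s) * (1 - t).
  by split; apply: mulr_ge0; lra.
lra.
Qed.

(** Whatever the parameters, the cell meets only the two sides of the square that
    lie on the axes, and each of them in the image of this same side. *)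
Lemma face_quad a b c d a' b' c' d' x y :
  good_cell a b c d -> good_cell a' b' c' d' -> square x -> face x y ->
  face (quad a b c d x) (quad a' b' c' d' y).
Proof.
have pos s u : 0 <= s <= 1 -> 0 < u < 1 -> (0 <= s * u <= 1) /\ s * u <> 1.
  by move=> *; split; [apply/andP; split|]; nra.
have zero s u : 0 < u < 1 -> s * u = 0 -> s = 0.
  by move=> hu /eqP; rewrite mulf_eq0 => /orP[]/eqP; lra.
case=> a1 b1 c1 d1 _ [a2 b2 c2 d2 _] /squareE[x1 x2].
move=> [/squareE[y1 y2] h1 h2 h3 h4].
have X := convex_comb_itv x2 a1 c1; have Y := convex_comb_itv x1 b1 d1.
have X' := convex_comb_itv y2 a2 c2; have Y' := convex_comb_itv y1 b2 d2.
have [sX nX] := pos _ _ x1 X; have [sY nY] := pos _ _ x2 Y.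
have [sX' nX'] := pos _ _ y1 X'; have [sY' nY'] := pos _ _ y2 Y'.
split; [by apply/squareE| |by move=> /nX| |by move=> /nY] => /=.
- by move=> /(zero _ _ X)/h1->; rewrite mul0r.
- by move=> /(zero _ _ Y)/h3->; rewrite mul0r.
Qed.

(** The difference of two values is the differential at the midpoint [(um, wm)]
    applied to the difference of the arguments; by Cramer's rule it is enough
    that the Jacobian [Jm] at the midpoint is positive.  [Jm] is affine in
    [(um, wm)], positive at three corners and not negative at [(1, 1)], and the
    midpoint of two distinct points of the square is not a corner. *)
Lemma quad_inj a b c d : good_cell a b c d ->
  {in square &, injective (quad a b c d)}.
Proof.
case=> a1 b1 c1 d1 J [u w] [u' w'].
move=> /set_mem/squareE[/= u1 w1] /set_mem/squareE[/= u2 w2] [/= X Y].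
have [->|ne] := eqVneq (u, w) (u', w'); first by [].
set um := (u + u') / 2; set wm := (w + w') / 2.
set Jm := a * b * (1 - um - wm) + um * (a * d) + wm * (c * b).
have JE : Jm = ((1 - wm) * a + wm * c) * ((1 - um) * b + um * d) -
    um * wm * (c - a) * (d - b).
  by rewrite /Jm; ring.
have Ju : Jm * (u - u') = 0.
  transitivity (
    ((1 - um) * b + um * d) *
      (u * ((1 - w) * a + w * c) - u' * ((1 - w') * a + w' * c)) -
    um * (c - a) * (w * ((1 - u) * b + u * d) - w' * ((1 - u') * b + u' * d))).
    by rewrite JE /um /wm; field.
  by rewrite X Y; ring.
have Jw : Jm * (w - w') = 0.
  transitivity (
    ((1 - wm) * a + wm * c) *
      (w * ((1 - u) * b + u * d) - w' * ((1 - u') * b + u' * d)) -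
    wm * (d - b) * (u * ((1 - w) * a + w * c) - u' * ((1 - w') * a + w' * c))).
    by rewrite JE /um /wm; field.
  by rewrite X Y; ring.
have um1 : 0 <= um <= 1 by rewrite /um; lra.
have wm1 : 0 <= wm <= 1 by rewrite /wm; lra.
have ad : 0 < a * d by nra.
have cb : 0 < c * b by nra.
have ab : 0 < a * b by nra.
have Jpos : 0 < Jm.
  have [lt|le] := ltP um wm.
    (* barycentric coordinates in the half of the square above the diagonal *)
    have -> : Jm = (1 - wm) * (a * b) + (wm - um) * (c * b) +
        um * (c * b + d * a - a * b).
      by rewrite /Jm; ring.
    have : 0 < (wm - um) * (c * b) by nra.
    have : 0 <= um * (c * b + d * a - a * b) by apply: mulr_ge0; lra.
    have : 0 <= (1 - wm) * (a * b) by nra.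
    lra.
  have -> : Jm = (1 - um) * (a * b) + (um - wm) * (a * d) +
      wm * (c * b + d * a - a * b).
    by rewrite /Jm; ring.
  have : 0 <= wm * (c * b + d * a - a * b) by apply: mulr_ge0; lra.
  have : 0 <= (um - wm) * (a * d) by nra.
  have [um_lt|um_ge] := ltP um 1.
    have : 0 < (1 - um) * (a * b) by nra.
    lra.
  have E : um = 1 by lra.
  have [wm_lt|wm_ge] := ltP wm 1.
    have : 0 < (um - wm) * (a * d) by nra.
    have : 0 <= (1 - um) * (a * b) by nra.
    lra.
  exfalso; move/eqP: ne; apply; rewrite /um /wm in E wm_ge.
  by congr pair; lra.
by congr pair; apply/eqP; rewrite -subr_eq0; apply/eqP;
 [move/eqP: Ju|move/eqP: Jw]; rewrite mulf_eq0 gt_eqF //= => /eqP.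
Qed.

(** The cell lies to the left of the line through [(a, 0)] and [(c, d)]: the
    oriented distance is [1 - u] times a factor which is not negative.  That
    factor vanishes only if the angle at [(c, d)] is flat and [w = 1], and then
    [u < 1] would put the image strictly above [Y = d]. *)
Lemma quad_left_below a b c d u w : good_cell a b c d ->
  0 <= u <= 1 -> 0 <= w <= 1 ->
  let X := (quad a b c d (u, w)).1 in let Y := (quad a b c d (u, w)).2 in
  Y <= d ->
  0 <= (a - c) * (d - Y) - (X - c) * d /\
  ((a - c) * (d - Y) - (X - c) * d = 0 -> u = 1).
Proof.
case=> a1 b1 c1 d1 J u1 w1 /= Yd.
have -> : (a - c) * (d - w * ((1 - u) * b + u * d)) -
    (u * ((1 - w) * a + w * c) - c) * d =
    (1 - u) * ((1 - w) * (d * a) + w * (c * b + d * a - a * b)) by ring.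
have da : 0 < d * a by nra.
have cb : 0 < c * b by nra.
have k1 : 0 <= (1 - w) * (d * a) by nra.
have k2 : 0 <= w * (c * b + d * a - a * b) by apply: mulr_ge0; lra.
split; first by apply: mulr_ge0; lra.
move=> /eqP; rewrite mulf_eq0 => /orP[/eqP|/eqP k0]; first by lra.
have w_eq1 : w = 1.
  have : (1 - w) * (d * a) = 0 by lra.
  by move=> /eqP; rewrite mulf_eq0 => /orP[]/eqP; lra.
have J0 : a * (b - d) = c * b by rewrite w_eq1 in k0; lra.
have bd : 0 < b - d by nra.
have : (1 - u) * (b - d) <= 0 by rewrite w_eq1 in Yd; lra.
by rewrite (pmulr_lle0 _ bd); lra.
Qed.

(** The cell lies below the line through [(0, b)] and [(c, d)].  If it has a point
    with [d <= Y] other than [(c, d)], then [d <= b], so that this line does not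
    rise to the right; it leaves the square at [(0, b)] with [b < 1], and the
    segment from [(c, d)] to the upper side passes to the right of it. *)
Lemma quad_left_above a b c d s u w : good_cell a b c d -> 0 < s < 1 ->
  0 <= u <= 1 -> 0 <= w <= 1 ->
  let X := (quad a b c d (u, w)).1 in let Y := (quad a b c d (u, w)).2 in
  d <= Y ->
  0 <= (s - c) * (Y - d) - (X - c) * (1 - d) /\
  ((s - c) * (Y - d) - (X - c) * (1 - d) = 0 -> u = 1).
Proof.
case=> a1 b1 c1 d1 J s1 u1 w1 /=.
set X := u * (_ + _); set Y := w * (_ + _) => dY.
have [u_eq1|u_lt1] : u = 1 \/ u < 1 by case: (ltP u 1); [right|left; lra].
  have w_eq1 : w = 1.
    have : (1 - w) * d <= 0 by move: dY; rewrite /Y u_eq1; lra.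
    by have d0 : 0 < d by [lra]; rewrite (pmulr_lle0 _ d0); lra.
  by rewrite /X /Y u_eq1 w_eq1; split=> //; lra.
suff : 0 < (s - c) * (Y - d) - (X - c) * (1 - d) by move=> ?; split=> //; lra.
have db : d <= b.
  have h : 0 <= (1 - w) * ((1 - u) * b + u * d).
    by apply: mulr_ge0; [lra|apply: addr_ge0; apply: mulr_ge0; lra].
  have : (1 - u) * (d - b) <= 0 by move: dY; rewrite /Y; lra.
  have u0 : 0 < 1 - u by lra.
  by rewrite (pmulr_rle0 _ u0); lra.
have [bd|bd] : d = b \/ d < b by case: (ltP d b); [right|left; lra].
  have w_eq1 : w = 1.
    have : (1 - w) * d <= 0 by move: dY; rewrite /Y -bd; lra.
    by have d0 : 0 < d by [lra]; rewrite (pmulr_lle0 _ d0); lra.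
  rewrite /X /Y -bd w_eq1.
  have -> : (s - c) * (1 * ((1 - u) * d + u * d) - d) -
      (u * ((1 - 1) * a + 1 * c) - c) * (1 - d) = (1 - u) * c * (1 - d) by ring.
  by rewrite !mulr_gt0//; lra.
have line : (c - X) * (b - d) - c * (Y - d) =
    (1 - w) * ((1 - u) * (b * c) + u * (c * b + d * a - a * b)).
  by rewrite /X /Y; ring.
have bc : 0 < b * c by nra.
have lpos : 0 < (1 - u) * (b * c) + u * (c * b + d * a - a * b).
  have : 0 <= u * (c * b + d * a - a * b) by apply: mulr_ge0; lra.
  have : 0 < (1 - u) * (b * c) by apply: mulr_gt0; lra.
  lra.
have lge : 0 <= (c - X) * (b - d) - c * (Y - d).
  by rewrite line; apply: mulr_ge0; lra.
have bd0 : 0 < b - d by lra.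
(* both slopes are compared after multiplication by [b - d] *)
rewrite -(pmulr_lgt0 _ bd0).
have -> : ((s - c) * (Y - d) - (X - c) * (1 - d)) * (b - d) =
    ((c - X) * (b - d) - c * (Y - d)) * (1 - d) +
    (Y - d) * (s * (b - d) + c * (1 - b)) by ring.
have [Yd|Yd] : Y = d \/ d < Y.
    by clear -dY; case: (ltP d Y); [right|left; lra].
  have w_lt1 : w < 1.
    case: (ltP w 1) => // w_ge1; have w_eq1 : w = 1 by clear -w1 w_ge1; lra.
    have : 0 < (1 - u) * (b - d) by apply: mulr_gt0; lra.
    by move: Yd; rewrite /Y w_eq1; lra.
  rewrite line Yd subrr mul0r addr0 !mulr_gt0//; lra.
apply: ltr_wpDl; first by apply: mulr_ge0; lra.
apply: mulr_gt0; first lra.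
have : 0 < s * (b - d) by apply: mulr_gt0; lra.
have : 0 < c * (1 - b) by apply: mulr_gt0; lra.
lra.
Qed.

(** * Four cells around a hub *)

(** The points in which the sides of the square are divided and the interior
    point to which they are joined.  [onx] gives the abscissas on the lower
    ([false]) and upper ([true]) side, [ony] the ordinates on the left and right
    side. *)
Record spokes := Spokes { onx : bool -> K; ony : bool -> K; hub : K * K }.

(** [ex] selects the right half and [ey] the upper half of the square; mirrored to
    the origin, each of the four cells is standard. *)
Definition subcell (m : spokes) ex ey : K * K -> K * K :=
  quad (flip ex (onx m ey)) (flip ey (ony m ex))
       (flip ex (hub m).1) (flip ey (hub m).2).

Definition cell (m : spokes) ex ey p := mirror ex ey (subcell m ex ey p).

Definition good_spokes (m : spokes) : Prop := forall ex ey,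
  good_cell (flip ex (onx m ey)) (flip ey (ony m ex))
            (flip ex (hub m).1) (flip ey (hub m).2).

(** Positive to the left of the broken line that joins the division points of the
    lower and the upper side through the hub, negative to its right. *)
Definition gap (m : spokes) p : K :=
  let: (ox, oy) := hub m in
  if p.2 <= oy then (onx m false - ox) * (oy - p.2) - (p.1 - ox) * oy
  else (onx m true - ox) * (p.2 - oy) - (p.1 - ox) * (1 - oy).

(** Mirroring reduces all four cells to the standard one; for the upper cells the
    lemmas on the parts below and above the hub change places. *)
Lemma cell_gap m (ex ey : bool) p : good_spokes m -> square p ->
  0 <= (-1) ^+ ex * gap m (cell m ex ey p) /\
  (gap m (cell m ex ey p) = 0 -> p.1 = 1).
Proof.
case: m p => mx my [ox oy] [u w] gm /squareE[/= u1 w1].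
have := gm ex ey; have [] := gm ex (~~ ey).
rewrite /gap /cell /subcell /=.
set a := flip ex (mx ey); set b := flip ey _.
set c := flip ex ox; set d := flip ey oy.
set s := flip ex (mx (~~ ey)).
move=> s1 _ _ _ _ gc.
have lo := quad_left_below gc u1 w1; have hi := quad_left_above gc s1 u1 w1.
move: lo hi; rewrite /=; move: (u * _) (w * _) => X Y lo hi.
have E : flip ex c = ox by rewrite /c /flip; case: (ex); lra.
case: ifPn => [le_Y|]; last rewrite -ltNge => lt_Y.
  have H : 0 <= (flip ex (mx false) - c) * (oy - flip ey Y) - (X - c) * oy /\
      ((flip ex (mx false) - c) * (oy - flip ey Y) - (X - c) * oy = 0 -> u = 1).
    move: lo hi le_Y; rewrite /a /d /s /flip; case: (ey) => /= lo hi le_Y.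
      have Yge : 1 - oy <= Y by lra.
      by have [h1 h2] := hi Yge; split=> [|h]; [lra|apply: h2; lra].
    by have [h1 h2] := lo le_Y; split=> [|h]; [lra|apply: h2; lra].
  move: H; rewrite /c /flip; case: (ex); rewrite ?expr0 ?expr1 => -[h1 h2];
    (split=> [|h]; [lra|apply: h2; lra]).
have H : 0 <= (flip ex (mx true) - c) * (flip ey Y - oy) - (X - c) * (1 - oy) /\
    ((flip ex (mx true) - c) * (flip ey Y - oy) - (X - c) * (1 - oy) = 0 ->
     u = 1).
  move: lo hi lt_Y; rewrite /a /d /s /flip; case: (ey) => /= lo hi lt_Y.
    have Yge : Y <= 1 - oy by lra.
    by have [h1 h2] := lo Yge; split=> [|h]; [lra|apply: h2; lra].
  by have [h1 h2] := hi (ltW lt_Y); split=> [|h]; [lra|apply: h2; lra].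
move: H; rewrite /c /flip; case: (ex); rewrite ?expr0 ?expr1 => -[h1 h2];
  (split=> [|h]; [lra|apply: h2; lra]).
Qed.

Lemma cell_left_right m ey ey' p p' : good_spokes m -> square p -> square p' ->
  cell m false ey p = cell m true ey' p' -> p.1 = 1 /\ p'.1 = 1.
Proof.
move=> gm pS pS' E.
have [l1 l2] := cell_gap false ey gm pS.
have [r1 r2] := cell_gap true ey' gm pS'.
rewrite -E in r1 r2; have g0 : gap m (cell m false ey p) = 0.
  by move: l1 r1; rewrite expr0 expr1; lra.
by split; [exact: l2|exact: r2].
Qed.

Definition transpose p : K * K := (p.2, p.1).

Lemma transpose_square p : square p -> square (transpose p).
Proof. by move=> /squareE[? ?]; apply/squareE. Qed.

Definition transpose_spokes m := Spokes (ony m) (onx m) (transpose (hub m)).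

Lemma good_transpose m : good_spokes m -> good_spokes (transpose_spokes m).
Proof.
by move=> gm ex ey; have [? ? ? ? J] := gm ey ex; split=> //=; move: J; lra.
Qed.

Lemma cell_transpose m ex ey p :
  cell (transpose_spokes m) ey ex (transpose p) = transpose (cell m ex ey p).
Proof. by []. Qed.

(** Cells in different columns are separated by [gap]; exchanging the coordinates
    gives the same for cells in different rows. *)
Lemma cell_overlap m ex ey ex' ey' p p' : good_spokes m -> square p -> square p' ->
  cell m ex ey p = cell m ex' ey' p' ->
  [/\ p = p', ex != ex' -> p.1 = 1 & ey != ey' -> p.2 = 1].
Proof.
move=> gm pS pS' E.
have hx : ex != ex' -> p.1 = 1 /\ p'.1 = 1.
  case: ex ex' E => -[] // E _; last exact: (cell_left_right gm pS pS' E).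
  by have [] := cell_left_right gm pS' pS (esym E).
have hy : ey != ey' -> p.2 = 1 /\ p'.2 = 1.
  have {}E : cell (transpose_spokes m) ey ex (transpose p) =
      cell (transpose_spokes m) ey' ex' (transpose p').
    by rewrite !cell_transpose E.
  have gm' := good_transpose gm.
  have qS := transpose_square pS; have qS' := transpose_square pS'.
  case: ey ey' E => -[] // E _; last exact: (cell_left_right gm' qS qS' E).
  by have [] := cell_left_right gm' qS' qS (esym E).
split; [|by case/hx|by case/hy].
have [_ _ c1 d1 _] := gm false false; rewrite /= in c1 d1.
have flip_inj e : injective (flip e) by move=> s t; rewrite /flip; case: e; lra.
have [ex_eq|/hx[x1 x1']] := eqVneq ex ex'; have [ey_eq|/hy[y1 y1']] := eqVneq ey ey'.
- apply: (quad_inj (gm ex ey)); rewrite ?inE//.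
  by move: E; rewrite -ex_eq -ey_eq => -[/flip_inj ? /flip_inj ?]; congr pair.
- move: E; rewrite -ex_eq /cell /subcell /mirror /quad y1 y1' => -[/flip_inj E _].
  have c0 : flip ex (hub m).1 != 0 by rewrite /flip; case: (ex); apply/eqP; lra.
  have : p.1 * flip ex (hub m).1 = p'.1 * flip ex (hub m).1 by lra.
  move=> /(mulIf c0) E1; rewrite (surjective_pairing p) (surjective_pairing p').
  by rewrite E1 y1 y1'.
- move: E; rewrite -ey_eq /cell /subcell /mirror /quad x1 x1' => -[_ /flip_inj E].
  have d0 : flip ey (hub m).2 != 0 by rewrite /flip; case: (ey); apply/eqP; lra.
  have : p.2 * flip ey (hub m).2 = p'.2 * flip ey (hub m).2 by lra.
  move=> /(mulIf d0) E1; rewrite (surjective_pairing p) (surjective_pairing p').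
  by rewrite E1 x1 x1'.
- by rewrite (surjective_pairing p) (surjective_pairing p') x1 y1 x1' y1'.
Qed.

Lemma cell_edgex m ex ex' ey p : p.1 = 1 -> cell m ex ey p = cell m ex' ey p.
Proof.
by move=> p1; rewrite /cell /subcell /quad /mirror /flip p1; case: ex ex' ey => -[] [];
  congr pair => /=; ring.
Qed.

Lemma cell_edgey m ex ey ey' p : p.2 = 1 -> cell m ex ey p = cell m ex ey' p.
Proof.
by move=> p2; rewrite /cell /subcell /quad /mirror /flip p2; case: ex ey ey' => -[] [];
  congr pair => /=; ring.
Qed.

Lemma face_cell m m' ex ey x y : good_spokes m -> good_spokes m' ->
  square x -> face x y -> face (cell m ex ey x) (cell m' ex ey y).
Proof. by move=> gm gm' xS xy; apply: face_mirror; exact: face_quad. Qed.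

Lemma cell_glue m m' ex ey ex' ey' p p' : good_spokes m ->
  square p -> square p' -> cell m ex ey p = cell m ex' ey' p' ->
  p = p' /\ forall q, face p q -> cell m' ex ey q = cell m' ex' ey' q.
Proof.
move=> gm pS pS' /(cell_overlap gm pS pS')[-> hx hy]; split=> // q [_ _ q1 _ q2].
have -> : cell m' ex ey q = cell m' ex' ey q.
  by have [->//|/hx/q1 ?] := eqVneq ex ex'; exact: cell_edgex.
by have [->//|/hy/q2 ?] := eqVneq ey ey'; exact: cell_edgey.
Qed.

(** Let [w] run from [0] to [1].  The broken line from [(0, w * t)] through the point
    [(al w, w * d)] of the spoke to [(1, w * r)] sweeps the strip below the hub,
    from the lower side to the broken line through the hub itself; its height
    [H w] over [X] is continuous in [w], so some line passes through [(X, Y)].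
    With [mu w] and [mu' w] truncated at [1], one formula for [H] covers both
    sides of the bend, since one of the two numbers is always [1]. *)
Lemma cover_strip s t r c d X Y :
  0 < s < 1 -> 0 < c < 1 -> 0 <= X <= 1 -> 0 <= Y ->
  let m := Num.min 1 (X / c) in let m' := Num.min 1 ((1 - X) / (1 - c)) in
  Y <= (1 - m) * t + (1 - m') * r + (m + m' - 1) * d ->
  exists2 p, square p &
    quad s t c d p = (X, Y) \/ quad (1 - s) r (1 - c) d p = (1 - X, Y).
Proof.
move=> s1 c1 X1 Y0 m m' Yle.
pose al w := (1 - w) * s + w * c.
have al01 w : 0 <= w <= 1 -> 0 < al w < 1.
  by move=> w1; exact: convex_comb_itv.
pose mu w := Num.min 1 (X / al w); pose mu' w := Num.min 1 ((1 - X) / (1 - al w)).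
pose H w := w * ((1 - mu w) * t + (1 - mu' w) * r + (mu w + mu' w - 1) * d).
have al_cont : continuous (al : K^o -> K^o).
  move=> w; apply: cvgD; apply: cvgM; try exact: cvg_cst; last exact: cvg_id.
  by apply: cvgB; [exact: cvg_cst|exact: cvg_id].
have Hcont : {within `[0, 1], continuous (H : K^o -> K^o)}.
  apply: continuous_in_subspaceT => w /set_mem; rewrite /= in_itv /= => w1.
  have /andP[al0 al1] := al01 w w1.
  have mu_cont : {for w, continuous (mu : K^o -> K^o)}.
    apply: continuous_min; first exact: cvg_cst.
    apply: cvgM; first exact: cvg_cst.
    by apply: cvgV; [rewrite gt_eqF|exact: al_cont].
  have mu_cont' : {for w, continuous (mu' : K^o -> K^o)}.
    apply: continuous_min; first exact: cvg_cst.
    apply: cvgM; first exact: cvg_cst.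
    apply: cvgV; first by rewrite gt_eqF// subr_gt0.
    by apply: cvgB; [exact: cvg_cst|exact: al_cont].
  apply: cvgM; first exact: cvg_id.
  apply: cvgD; last first.
    by apply: cvgM; [apply: cvgB; [exact: cvgD|exact: cvg_cst]|exact: cvg_cst].
  by apply: cvgD; (apply: cvgM; [apply: cvgB => //; exact: cvg_cst|exact: cvg_cst]).
have H0 : H 0 = 0 by rewrite /H mul0r.
have H1 : Y <= H 1 by rewrite /H /mu /mu' /al subrr mul0r add0r !mul1r.
have [w] : exists2 w, w \in `[0, 1] & H w = Y.
  apply: (IVT ler01 Hcont); rewrite H0 ge_min Y0 /= le_max H1 orbT //.
rewrite in_itv /= => w1 HY; have /andP[al0 al1] := al01 w w1.
have al1' : 0 < 1 - al w by lra.
have [X_le|X_gt] := leP X (al w).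
  have mE : mu w = X / al w.
    by apply/min_idPr; rewrite ler_pdivrMr// mul1r.
  have mE' : mu' w = 1 by apply/min_idPl; rewrite ler_pdivlMr// mul1r; lra.
  have mu1 : 0 <= mu w <= 1.
    by rewrite mE ler_pdivrMr// mul1r X_le divr_ge0//; lra.
  exists (mu w, w); first exact/squareE.
  left; congr pair => /=; first by rewrite -/(al w) mE divfK// gt_eqF.
  by rewrite -HY /H mE'; ring.
have mE : mu w = 1 by apply/min_idPl; rewrite ler_pdivlMr// mul1r; lra.
have mE' : mu' w = (1 - X) / (1 - al w).
  by apply/min_idPr; rewrite ler_pdivrMr// mul1r; lra.
have mu1 : 0 <= mu' w <= 1.
  by rewrite mE' ler_pdivrMr// mul1r divr_ge0//; lra.
exists (mu' w, w); first exact/squareE.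
right; congr pair => /=; last by rewrite -HY /H mE; ring.
have -> : (1 - w) * (1 - s) + w * (1 - c) = 1 - al w by rewrite /al; ring.
by rewrite mE' divfK// gt_eqF.
Qed.

(** A point which is not in the strip below the broken line from left to right
    through the hub is in the mirror image of such a strip. *)
Lemma cell_cover m x : good_spokes m -> square x ->
  exists ex ey, exists2 p, square p & cell m ex ey p = x.
Proof.
move=> gm; case: x => X Y /squareE[/= X1 Y1].
have [a1 _ c1 _ _] := gm false false; have [s1 _ _ _ _] := gm false true.
move: a1 c1 s1 => /= a1 c1 s1.
set c := (hub m).1 in c1 *; set d := (hub m).2.
pose mu := Num.min 1 (X / c); pose mu' := Num.min 1 ((1 - X) / (1 - c)).
pose H :=
  (1 - mu) * ony m false + (1 - mu') * ony m true + (mu + mu' - 1) * d.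
have [YH|HY] := leP Y H.
  have Y0 : 0 <= Y by lra.
  have [p pS [E|E]] := cover_strip a1 c1 X1 Y0 YH.
    by exists false, false, p.
  exists true, false, p => //; rewrite /cell /subcell /= E /mirror /=; congr pair; ring.
have Y0 : 0 <= 1 - Y by lra.
have YH : 1 - Y <= (1 - mu) * (1 - ony m false) +
    (1 - mu') * (1 - ony m true) + (mu + mu' - 1) * (1 - d).
  by move: HY; rewrite /H; lra.
have [p pS [E|E]] := cover_strip s1 c1 X1 Y0 YH.
  exists false, true, p => //; rewrite /cell /subcell /= E /mirror /=; congr pair; ring.
exists true, true, p => //; rewrite /cell /subcell /= E /mirror /=; congr pair; ring.
Qed.

(** * Reduction to the standard form *)

Lemma cyclic_labelling_symm (s : seq (K * K)) : cyclic_labelling s ->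
  exists e, s = [seq symm e x | x <- corners].
Proof.
case=> k; have [k4|k4] := leqP 4 k.
  rewrite !rot_oversize ?size_rev// => -[] ->;
    [exists (false, false, false)|exists (false, false, true)];
    by rewrite /symm /mirror /flip /= ?subrr ?subr0.
case: k k4 => [|[|[|[|//]]]] _ [] ->;
 [exists (false, false, false)|exists (false, false, true)
 |exists (true, true, false)|exists (true, true, true)
 |exists (false, true, true)|exists (false, true, false)
 |exists (true, false, true)|exists (true, false, false)];
 by rewrite /symm /mirror /flip /= ?subrr ?subr0.
Qed.

(** The bi-affine map with given values at the four corners, as a function of [z]. *)
Definition blend z p0 p1 p2 p3 : K * K :=
  ((1 - z.1) * (1 - z.2)) *: p0 + (z.1 * (1 - z.2)) *: p1 +
  (z.1 * z.2) *: p2 + ((1 - z.1) * z.2) *: p3.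

Lemma biaffine_blend f e z : biaffine f ->
  f (symm e z) = blend z (f (symm e (0, 0))) (f (symm e (1, 0)))
                         (f (symm e (1, 1))) (f (symm e (0, 1))).
Proof.
move=> [a [b [c [d fE]]]]; rewrite !fE /blend /symm /mirror /flip.
by case: e => [[[] []] []]; congr pair => /=; rewrite /GRing.scale /=; ring.
Qed.

Lemma symm_blend e z p0 p1 p2 p3 :
  symm e (blend z p0 p1 p2 p3) =
  blend z (symm e p0) (symm e p1) (symm e p2) (symm e p3).
Proof.
rewrite /blend /symm /mirror /flip.
by case: e => [[[] []] []]; congr pair => /=; rewrite /GRing.scale /=; ring.
Qed.

Lemma mirror_quad ex ey a b c d z :
  mirror ex ey (quad a b c d z) =
  blend z (mirror ex ey (0, 0)) (mirror ex ey (a, 0))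
          (mirror ex ey (c, d)) (mirror ex ey (0, b)).
Proof.
rewrite /blend /mirror /flip /quad.
by case: ex ey => -[]; congr pair => /=; rewrite /GRing.scale /=; ring.
Qed.

(** Symmetries of the square may reverse the orientation, but the convexity
    condition only compares signs of [orient] along one edge. *)
Definition scales_orient (phi : K * K -> K * K) : Prop :=
  exists2 k : K, k != 0 &
  forall p q x, orient (phi p) (phi q) (phi x) = k * orient p q x.

Lemma scales_orient_symm e ex ey : scales_orient (symm e \o mirror ex ey).
Proof.
exists ((-1) ^+ (e.1.1 (+) e.1.2 (+) e.2 (+) ex (+) ey)); first by rewrite signr_eq0.
move=> p q x; rewrite /orient /symm /mirror /flip.
by case: e => [[[] []] []]; case: ex; case: ey => /=; rewrite ?expr0 ?expr1; ring.
Qed.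

(** Along the edge from [(a, 0)] to [(c, d)] the vertex [(0, 0)] has orientation
    [a * d > 0], so that of [(0, b)] is not negative. *)
Lemma convex_good phi a b c d : scales_orient phi ->
  0 < a < 1 -> 0 < b < 1 -> 0 < c < 1 -> 0 < d < 1 ->
  convex_polygon [:: phi (0, 0); phi (a, 0); phi (c, d); phi (0, b)] ->
  good_cell a b c d.
Proof.
move=> [k k0 phiE] a1 b1 c1 d1; rewrite /convex_polygon /= !phiE /orient /=.
move=> /and5P[_ H _ _ _]; split=> //.
have ad : 0 < a * d by nra.
suff : 0 <= (k * (a * d)) * (k * (c * b + d * a - a * b)).
  have k2 : 0 < k ^+ 2 by rewrite exprn_even_gt0.
  have -> : (k * (a * d)) * (k * (c * b + d * a - a * b)) =
    (k ^+ 2 * (a * d)) * (c * b + d * a - a * b) by ring.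
  by rewrite (pmulr_rge0 _ (mulr_gt0 k2 ad)); lra.
case/orP: H => /and5P[h1 _ _ h2 _]; [apply: mulr_ge0|apply: mulr_le0]; lra.
Qed.

Lemma interior_square x : (square° : set (K * K)) x ->
  0 < x.1 < 1 /\ 0 < x.2 < 1.
Proof.
rewrite /interior /= => /nbhs_ballP[e /= e0 xe].
have sub (t1 t2 : K) : `|t1| < e -> `|t2| < e -> square (x.1 + t1, x.2 + t2).
  move=> h1 h2; apply: xe.
  by split; rewrite /ball /= /ball_ opprD addrA subrr sub0r normrN.
have e2 : `|e / 2| < e by rewrite gtr0_norm; lra.
have e2' : `|- (e / 2)| < e by rewrite normrN.
have /squareE[/= ? ?] := sub _ _ e2 e2; have /squareE[/= ? ?] := sub _ _ e2' e2'.
by split; lra.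
Qed.

Lemma interior_symm e x : (square° : set (K * K)) x ->
  exists2 o, x = symm e o & 0 < o.1 < 1 /\ 0 < o.2 < 1.
Proof.
move=> /interior_square[x1 x2]; exists (symm (symmV e) x); first by rewrite symmVK.
by case: e => [[[] []] []]; rewrite /symm /mirror /flip /=; split; lra.
Qed.

Lemma segment_symm e p q x : open_segment (symm e p) (symm e q) x ->
  exists2 t : K, 0 < t < 1 & x = symm e ((1 - t) *: p + t *: q).
Proof.
move=> [t /=]; rewrite in_itv /= => t1 <-; exists t => //.
by case: e => [[[] []] []]; rewrite /symm /mirror /flip; congr pair => /=;
  rewrite /GRing.scale /=; ring.
Qed.

(** The position of the cell of [A], [B], [C] or [D] when these corners are read as
    [(0, 0)], [(1, 0)], [(1, 1)], [(0, 1)]. *)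
Definition right_half (i : 'I_4) : bool := (i == 1 :> nat) || (i == 2 :> nat).
Definition top_half (i : 'I_4) : bool := (2 <= i)%N.

Lemma half_surj ex ey : exists i, right_half i = ex /\ top_half i = ey.
Proof.
case: ex ey => -[].
- by exists (@Ordinal 4 2 isT).
- by exists (@Ordinal 4 1 isT).
- by exists (@Ordinal 4 3 isT).
- by exists (@Ordinal 4 0 isT).
Qed.

(** Every cell lists its vertices starting from a corner of the square and going
    first to a point of the lower or upper side, so the four lists are mirror
    images of one pattern, and a bi-affine map is determined by its values at
    the corners. *)
Lemma biaffine_ifs_cell e e' A B C D v O Q R S T
    (f : 'I_4 -> K * K -> K * K) :
  [:: A; B; C; D] = [seq symm e x | x <- corners] ->
  v = [seq symm e' x | x <- corners] ->
  biaffine_ifs A B C D v O Q R S T f ->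
  exists2 m, good_spokes m &
    forall i z, f i (symm e' z) = symm e (cell m (right_half i) (top_half i) z).
Proof.
move=> [-> -> -> ->] -> [[hO [hQ hR hS hT] conv] faff fv].
have [ctr OE [c1 c2]] := interior_symm e hO.
have [q0 q1 QE] := segment_symm hQ; have [r0 r1 RE] := segment_symm hR.
have [s0 s1 SE] := segment_symm hS; have [t0 t1 TE] := segment_symm hT.
(* The upper and the left side are traversed against the coordinate axes. *)
pose m := Spokes (fun h : bool => if h then 1 - s0 else q0)
                 (fun h : bool => if h then r0 else 1 - t0) ctr.
pose vertices (ex ey : bool) := [seq symm e (mirror ex ey x) | x <-
  [:: (0, 0); (flip ex (onx m ey), 0);
      (flip ex ctr.1, flip ey ctr.2); (0, flip ey (ony m ex))]].
have cellsE (i : 'I_4) : nth [::] (cells (symm e (0, 0)) (symm e (1, 0))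
    (symm e (1, 1)) (symm e (0, 1)) O Q R S T) i =
    vertices (right_half i) (top_half i).
  by case: i => -[|[|[|[|//]]]] ilt /=; rewrite OE ?QE ?RE ?SE ?TE;
    congr [:: symm e _; symm e _; symm e _; symm e _]; rewrite /mirror /flip /=;
    case: (ctr) => ox oy; congr pair => /=; rewrite /GRing.scale /=; ring.
have gm : good_spokes m.
  move=> ex ey; have conv_ex_ey : convex_polygon (vertices ex ey).
    have [i [<- <-]] := half_surj ex ey.
    by rewrite -cellsE; move/allP: conv; apply; apply: mem_nth; case: (i).
  apply: (convex_good (scales_orient_symm e ex ey) _ _ _ _ conv_ex_ey);
    by rewrite /flip /m /=; case: (ex); case: (ey); clear -q1 r1 s1 t1 c1 c2; lra.
exists m => // i z; rewrite biaffine_blend// /cell /subcell mirror_quad symm_blend.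
by have := fv i; rewrite cellsE => -[-> -> -> ->].
Qed.
(** Two systems in standard form with the same symmetries [e] and [e'] differ in
    the spokes only, and incidences do not depend on these. *)
Lemma face_compatible_cells e e' m m' (f g : 'I_4 -> K * K -> K * K) :
  good_spokes m -> good_spokes m' ->
  (forall i z,
     f i (symm e' z) = symm e (cell m (right_half i) (top_half i) z)) ->
  (forall i z,
     g i (symm e' z) = symm e (cell m' (right_half i) (top_half i) z)) ->
  face_compatible f g.
Proof.
move=> gm gm' fE gE; have symmVE := symmVK e'.
have fE' i y : f i y =
    symm e (cell m (right_half i) (top_half i) (symm (symmV e') y)).
  by rewrite -{1}[y]symmVE fE.
have gE' i y : g i y =
    symm e (cell m' (right_half i) (top_half i) (symm (symmV e') y)).
  by rewrite -{1}[y]symmVE gE.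
split=> [i j y z yS zS|i y y' yS yy'].
  rewrite !fE' => /(can_inj (symmK e)).
  move=> /(cell_glue m' gm (symm_square _ yS) (symm_square _ zS)).
  move=> [/(can_inj (symmVE)) yz glue]; split=> // y' yy'.
  by rewrite !gE' glue//; exact: face_symm.
rewrite fE' gE'; apply/face_symm/face_cell => //; last exact: face_symm.
exact: symm_square.
Qed.

Lemma biaffine_continuous (f : K * K -> K * K) : biaffine f -> continuous f.
Proof.
move=> [a [b [c [d fE]]]] z.
have -> : f = fun z => a + z.1 *: b + z.2 *: c + (z.1 * z.2) *: d.
  exact/funext.
have c1 : (y.1 : K^o) @[y --> z] --> (z.1 : K^o) by exact: cvg_fst.
have c2 : (y.2 : K^o) @[y --> z] --> (z.2 : K^o) by exact: cvg_snd.
by apply: cvgD; [apply: cvgD; [apply: cvgD; [exact: cvg_cst|]|]|];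
  apply: cvgZr_tmp => //; exact: cvgM.
Qed.

Lemma norm_le_edist x y : `|x - y| <= Defs.edist x y.
Proof.
rewrite /Defs.edist prod_normE ge_max /= -!sqrtr_sqr; apply/andP; split.
  by rewrite ler_sqrt ?lerDl ?addr_ge0 ?sqr_ge0.
by rewrite ler_sqrt ?lerDr ?addr_ge0 ?sqr_ge0.
Qed.

Lemma edist_square x y : square x -> square y -> Defs.edist x y <= 2.
Proof.
move=> /squareE[x1 x2] /squareE[y1 y2]; rewrite /Defs.edist.
have -> : (2 : K) = Num.sqrt (2 ^+ 2) by rewrite sqrtr_sqr ger0_norm.
by rewrite ler_sqrt ?sqr_ge0//; nra.
Qed.

Lemma contractive_shrinking (f : 'I_4 -> K * K -> K * K) :
  (forall i x, square x -> square (f i x)) -> contractive_ifs f -> shrinking f.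
Proof.
move=> fS cf.
have [c /andP[c0 c1] hc] : exists2 c : K, 0 <= c < 1 & forall i x y,
    square x -> square y -> Defs.edist (f i x) (f i y) <= c * Defs.edist x y.
  (* the maximum is taken with [0] because contraction constants may be negative *)
  have /choice[c hc] : forall i, exists c : K, c < 1 /\ forall x y,
      square x -> square y -> Defs.edist (f i x) (f i y) <= c * Defs.edist x y.
    by move=> i; have [c] := cf i; exists c.
  exists (\big[Num.max/0]_i c i).
    rewrite bigmax_ge_id /=; apply/bigmax_ltP; split=> // i _; exact: (hc i).1.
  move=> i x y xS yS; apply: le_trans ((hc i).2 x y xS yS) _.
  by rewrite ler_wpM2r ?sqrtr_ge0//; exact: le_bigmax.
have hw (w : seq 'I_4) x y : square x -> square y ->
    Defs.edist (foldr f x w) (foldr f y w) <= c ^+ size w * Defs.edist x y.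
  move=> xS yS; elim: w => [|i w IH] /=; first by rewrite expr0 mul1r.
  apply: le_trans (hc i _ _ _ _) _; try exact: foldr_square.
  by rewrite exprS -mulrA ler_wpM2l.
move=> e e0.
have /cvgrPdist_le/(_ _ (divr_gt0 e0 (ltr0Sn _ 1))) [N _ hN] :
    (c ^+ n) @[n --> \oo] --> (0 : K^o).
  by apply: cvg_expr; rewrite ger0_norm.
exists N => w x y Nw xS yS.
apply: le_trans (norm_le_edist _ _) _; apply: le_trans (hw _ _ _ xS yS) _.
have := hN _ Nw; rewrite sub0r normrN normrX ger0_norm// ler_pdivlMr//.
apply: le_trans; rewrite ler_wpM2l ?exprn_ge0//; exact: edist_square.
Qed.

Lemma self_covering_cells e e' m (f : 'I_4 -> K * K -> K * K) :
  good_spokes m -> (forall i, biaffine (f i)) -> contractive_ifs f ->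
  (forall i z,
     f i (symm e' z) = symm e (cell m (right_half i) (top_half i) z)) ->
  self_covering f.
Proof.
move=> gm faff cf fE.
have fS i x : square x -> square (f i x).
  have [_ /(_ i x x)] := face_compatible_cells gm gm fE fE.
  move=> ff xS; have := ff xS (face_refl xS).
  exact: face_square.
split=> //; last exact: contractive_shrinking.
- move=> x xS.
  have [ex [ey [p pS E]]] := cell_cover gm (symm_square (symmV e) xS).
  have [i [hx hy]] := half_surj ex ey; exists i; exists (symm e' p).
    exact: symm_square.
  by rewrite fE hx hy E symmVK.
- by move=> i; exact: biaffine_continuous.
Qed.

End Geometry.

Theorem theorem6 (K : realType) (A B C D : K * K) (v : seq (K * K))
    (O Q R S T O' Q' R' S' T' : K * K) (f g : 'I_4 -> K * K -> K * K)
    (hABCD : cyclic_labelling [:: A; B; C; D])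
    (hv : cyclic_labelling v)
    (hf : biaffine_ifs A B C D v O Q R S T f)
    (hg : biaffine_ifs A B C D v O' Q' R' S' T' g)
    (cf : contractive_ifs f) (cg : contractive_ifs g) :
  homeomorphism square square
    (fun x => coding_map g (mask_section f x)).
Proof.
have [e eE] := cyclic_labelling_symm hABCD.
have [e' e'E] := cyclic_labelling_symm hv.
have [m gm fE] := biaffine_ifs_cell eE e'E hf.
have [m' gm' gE] := biaffine_ifs_cell eE e'E hg.
have [_ faff _] := hf; have [_ gaff _] := hg.
apply: conjugation_homeomorphism.
- exact: self_covering_cells gm faff cf fE.
- exact: self_covering_cells gm' gaff cg gE.
- exact: face_compatible_cells gm gm' fE gE.
- exact: face_compatible_cells gm' gm gE fE.
Qed.
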